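(* Let $X,Y,Z$ be compact convex sets in finite-dimensional real vector spaces and let $f:Y\to X$ be an affine map. If $\dim(\mathrm{Im} f)=\dim X$, then $\partial X$ is a strong deformation retract of $C(Z,f)$. In all other cases, $C(Z,f)$ is contractible.
   Context: $\mathrm{relint}$ denotes relative interior and $\partial X=X\setminus\mathrm{relint}(X)$. $\mathrm{Hom}(Z,X)$ is the set of affine maps $Z\to X$, viewed as a compact convex subset of the (finite-dimensional) affine space of affine maps $\mathrm{Aff}(Z)\to\mathrm{Aff}(X)$, where $\mathrm{Aff}$ denotes affine hull. The set $$C(Z,f)=\overline{\{g\in\mathrm{Hom}(Z,X)\mid g(Z)\cap\mathrm{relint}(\mathrm{Im} f)=\emptyset\}}$$ (closure in the Euclidean topology) carries the subspace topology. A point $x\in X$ is identified with the constant map $Z\to X$ with value $x$; in this way $\partial X$ is viewed as a subset of $C(Z,f)$ when $\dim(\mathrm{Im} f)=\dim X$. *)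

(* Defs.v *)
From HB Require Import structures.
From mathcomp Require Import all_boot all_order all_algebra.
From mathcomp Require Import all_classical all_reals all_analysis.
From mathcomp Require Import lra.

Set Implicit Arguments.
Unset Strict Implicit.
Unset Printing Implicit Defensive.

Import Order.TTheory GRing.Theory Num.Theory.
Import numFieldNormedType.Exports.

Local Open Scope classical_set_scope.
Local Open Scope ring_scope.

(* All norms on a finite-dimensional real vector space are equivalent, so the
   topology of such a space is the Euclidean one. *)
#[short(type="normedVectType")]
HB.structure Definition NormedVector (R : numFieldType) :=
  {V of NormedModule R V & Vector R V}.

HB.instance Definition _ (R : numFieldType) (m n : nat) :=
  Vector.on 'M[R]_(m, n).

Section AffineGeometry.
Context {R : realType} {V : normedVectType R}.
Implicit Type A : set V.

Definition affine_set A :=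
  forall (x y : V) (t : R), A x -> A y -> A ((1 - t) *: x + t *: y).

Definition aff A : set V := smallest affine_set A.

(* In subspace (aff A) the points outside aff A are isolated; they do not
   matter here because A `<=` aff A. *)
Definition relint A : set V := (A : set (subspace (aff A)))°.

Definition relboundary A : set V := A `\` relint A.

(* For nonempty A such a linear subspace exists, see directionE. *)
Definition direction A : {vspace V} :=
  xget 0%VS [set U : {vspace V} |
    [set` U] = [set x - y | x in aff A & y in aff A]].

(* The empty set has dimension -1. *)
Definition affine_dim A : int :=
  if `[< A = set0 >] then -1 else (\dim (direction A))%:Z.

Lemma sub_aff A : A `<=` aff A.
Proof. exact: sub_smallest. Qed.

Lemma aff_affine A : affine_set (aff A).
Proof.
by move=> x y t Ax Ay B AB; apply: AB.1; [exact: Ax|exact: Ay].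
Qed.

Lemma directionE A : A !=set0 ->
  [set` direction A] = [set x - y | x in aff A & y in aff A].
Proof.
move=> [a0 Aa0]; have h0 := sub_aff Aa0.
set D := [set x - y | x in aff A & y in aff A].
have DE v : D v <-> aff A (a0 + v).
  split=> [[x hx [y hy <-]]|hv]; last first.
    by exists (a0 + v) => //; exists a0 => //; rewrite addrC addKr.
  have hm := @aff_affine A _ _ (2%:R^-1) h0 hx.
  have := @aff_affine A _ _ (2%:R) hy hm.
  rewrite scalerDr !scalerA divff ?pnatr_eq0// scale1r.
  have -> : (2%:R * (1 - 2%:R^-1) : R) = 1.
    by rewrite mulrBr divff ?pnatr_eq0// mulr1; lra.
  rewrite scale1r (_ : 1 - 2%:R = -1 :> R); last by lra.
  by rewrite scaleN1r addrCA [- y + x]addrC.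
have DZ t v : D v -> D (t *: v).
  move=> /DE hv; apply/DE; have := @aff_affine A _ _ (t) h0 hv.
  by rewrite scalerDr addrA -scalerDl subrK scale1r.
have DD u v : D u -> D v -> D (u + v).
  move=> /(DZ 2%:R)/DE hu /(DZ 2%:R)/DE hv; apply/DE.
  have := @aff_affine A _ _ (2%:R^-1) hu hv.
  rewrite !scalerDr !scalerA mulVf ?pnatr_eq0// scale1r.
  rewrite mulrBl mulVf ?pnatr_eq0// mul1r.
  rewrite (_ : 2%:R - 1 = 1 :> R); last by lra.
  by rewrite scale1r addrACA -scalerDl subrK scale1r.
pose P n := `[< exists2 U : {vspace V}, [set` U] `<=` D & \dim U = n >].
have P0 : exists n, P n.
  exists 0%N; apply/asboolP; exists 0%VS; last exact: dimv0.
  move=> v /=; rewrite memv0 => /eqP ->; apply/DE; by rewrite addr0.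
have Pb n : P n -> (n <= \dim {:V})%N.
  by move=> /asboolP[U _ <-]; exact: dimvS (subvf U).
have [n /asboolP[U UD dU] nmax] := ex_maxnP P0 Pb.
have UE : [set` U] = D.
  apply/seteqP; split=> // d Dd; apply: contrapT => /= /negP dU'.
  have : P (\dim (U + <[d]>)%VS).
    apply/asboolP; exists (U + <[d]>)%VS => // v /= /memv_addP[u uU [w]].
    by move=> /vlineP[k ->] ->; apply: DD; [exact: UD|exact: DZ].
  move=> /nmax; rewrite -dU leqNgt => /negP; apply.
  rewrite ltn_neqAle dimvS ?addvSl// andbT.
  apply: contra dU' => /eqP e.
  have /eqP -> : U == (U + <[d]>)%VS by rewrite eqEdim addvSl e leqnn.
  exact: subvP (addvSr _ _) _ (memv_line d).
by rewrite /direction; case: xgetP => [W _ //|/(_ U)]; case.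
Qed.

End AffineGeometry.

Section AffineHom.
Context {R : realType} {V W : normedVectType R}.

Definition affine_map (A : set V) (g : A -> W) :=
  forall (x y z : A) (t : R), 0 <= t <= 1 ->
    \val z = (1 - t) *: \val x + t *: \val y ->
    g z = (1 - t) *: g x + t *: g y.

(* For A convex, an affine map A -> B extends uniquely to an affine map
   aff A -> aff B. The values at an affine basis of aff A chosen in A are affine
   coordinates on the space of all affine maps aff A -> aff B, and the value at
   any other point is a fixed affine combination of them: the topology of
   pointwise convergence on A is thus the Euclidean topology of that space. *)
Definition affine_hom (A : set V) (B : set W) : set {ptws A -> W} :=
  [set g | affine_map g /\ range g `<=` B].

End AffineHom.
Arguments affine_hom {R V W} A B.

(* The ambient space of the closure is that of all functions Z -> U; the result
   is the closure in Hom(Z, X), which is a closed subset of it for X compact. *)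
Definition avoiding {R : realType} {U V W : normedVectType R}
    (X : set U) (Y : set V) (Z : set W) (f : Y -> U) : set {ptws Z -> U} :=
  closure [set g | affine_hom Z X g /\ range g `&` relint (range f) = set0].
Arguments avoiding {R U V W} X {Y} Z f.

Section Homotopy.
Context (R : realType) {T : topologicalType}.
Implicit Types A C : set T.

Definition strong_deformation_retract A C :=
  A `<=` C /\
  exists H : R * T -> T,
    [/\ {within `[0, 1] `*` C, continuous H},
        forall t x, t \in `[0, 1] -> C x -> C (H (t, x)),
        forall x, C x -> H (0, x) = x,
        forall x, C x -> A (H (1, x)) &
        forall t x, t \in `[0, 1] -> A x -> H (t, x) = x].

Definition contractible C :=
  exists2 p, C p &
  exists H : R * T -> T,
    [/\ {within `[0, 1] `*` C, continuous H},
        forall t x, t \in `[0, 1] -> C x -> C (H (t, x)),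
        forall x, C x -> H (0, x) = x &
        forall x, C x -> H (1, x) = p].

End Homotopy.

(* Main.v *)
Require Import Defs.
From mathcomp Require Import all_boot all_order all_algebra.
From mathcomp Require Import all_classical all_reals all_analysis.
From mathcomp Require Import ring lra.
Import Order.TTheory GRing.Theory Num.Theory.
Import numFieldNormedType.Exports.
Local Open Scope classical_set_scope.
Local Open Scope ring_scope.
Set Implicit Arguments.
Unset Strict Implicit.
Unset Printing Implicit Defensive.

(** Write I for the image of f, a convex set. A map Z -> X deforms to a constant
    inside its own image, by moving every value straight towards its value at a
    fixed point z0 of Z, and this keeps the image off relint I. Hence only the
    constant maps matter, that is, points of X.

    If dim I = dim X, then I and X span the same affine space, so relint I is
    open relative to X; avoiding it is then a closed condition and C(Z, f) needs
    no closure ([hom_avoiding_closed]). Fix p in relint I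
    ([relint_nonempty]) and let rho be the radial projection of X \ {p} from p
    onto the relative boundary of X, which is continuous because the gauge of X
    at p is Lipschitz ([gauge_lipschitz]). The straight-line homotopy
      H(t, g)(z) = (1 - t) g(z) + t rho(g(z0))
    already does everything. Indeed, if H(t, g)(z) were in relint I, then
    so would be the segment from it to p; that segment meets the segment
    from g(z) to g(z0), which lies in the image of g
    ([push_away_avoids]). Boundary points are fixed by rho, so the
    retraction is strong.

    If dim I < dim X (or I is empty), some q in X lies outside aff I. Moving a
    point of aff I slightly towards q takes it off aff I, so every constant map
    with value in X is a limit of constants avoiding relint I
    ([cst_avoiding_closure]). Thus C(Z, f) contracts: first shrink g to the
    constant g(z0), then move that constant to q along a segment of X. *)

(** * Vector identities *)

(** Coordinate forms separate points, which reduces an identity between linear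
    combinations of vectors to a field identity between scalars. *)
Lemma linear_form_separation (F : fieldType) (V : vectType F) (x y : V) :
  (forall phi : V -> F, {morph phi : u v / u + v} ->
     {morph phi : u / - u} -> (forall a u, phi (a *: u) = a * phi u) ->
     phi x = phi y) ->
  x = y.
Proof.
move=> h; rewrite (coord_vbasis (memvf x)) (coord_vbasis (memvf y)).
apply: eq_bigr => i _; congr (_ *: _); apply: h => [u v|u|a u].
- exact: linearD.
- exact: linearN.
- exact: linearZ.
Qed.

Ltac vec_field :=
  let phi := fresh "phi" in let phiD := fresh "phiD" in
  let phiN := fresh "phiN" in let phiZ := fresh "phiZ" in
  apply: linear_form_separation => phi phiD phiN phiZ;
  rewrite !(phiD, phiN, phiZ); field.

(** * Affine hulls and relative interiors *)

Section ConvexGeometry.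
Context {R : realType} {V : normedVectType R}.
Implicit Types (A B K : set V) (x y p v : V).

Lemma convex_comb A x y (t : R) : convex_set A -> A x -> A y ->
  0 <= t <= 1 -> A ((1 - t) *: x + t *: y).
Proof.
move=> cA Ax Ay /andP[t0 t1].
have := cA y x (Itv01 t0 t1) (mem_set Ay) (mem_set Ax).
by rewrite inE addrC.
Qed.

Lemma affine_subset A B : affine_set B -> A `<=` B -> aff A `<=` B.
Proof. by move=> aB AB x; apply. Qed.

(** The point is the midpoint of p + 2 c (y - p) and p - 2 c (x - p), each on a
    line through two points of the hull. *)
Lemma aff_parallelogram A p x y (c : R) :
  aff A p -> aff A x -> aff A y -> aff A (p + c *: (y - x)).
Proof.
move=> Ap Ax Ay.
have ay := @aff_affine _ _ A p y (2 * c) Ap Ay.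
have ax := @aff_affine _ _ A p x (- (2 * c)) Ap Ax.
have := @aff_affine _ _ A _ _ (2^-1) ay ax.
by congr (aff A _); vec_field.
Qed.

Lemma relint_sub A : relint A `<=` A.
Proof. by move=> x; exact: (@interior_subset (subspace (aff A))). Qed.

Lemma relintP A x : relint A x <->
  aff A x /\ exists2 e : R, 0 < e & forall y, aff A y -> `|x - y| < e -> A y.
Proof.
split=> [hx|[xA [e e0 eA]]].
  have xA : aff A x by apply: sub_aff; exact: relint_sub.
  split=> //; move: hx; rewrite /relint /interior /= /nbhs/=.
  rewrite -nbhs_subspace_in//.
  move=> /nbhs_ballP[e /= e0 eA]; exists e => // y yA xy.
  by apply: eA => //; rewrite -ball_normE.
rewrite /relint /interior /= /nbhs/= -nbhs_subspace_in//.
apply/nbhs_ballP; exists e => //= y; rewrite -ball_normE /= => xy yA.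
exact: eA.
Qed.

(** The homothety with centre y and ratio 1 - t maps a relative ball about p
    that lies in A to a relative ball about the given point. *)
Lemma relint_comb A p y (t : R) : convex_set A -> relint A p -> A y ->
  0 <= t < 1 -> relint A ((1 - t) *: p + t *: y).
Proof.
move=> cA /relintP[pA [e e0 eA]] Ay /andP[t0 t1].
have t1' : 0 < 1 - t by rewrite subr_gt0.
have yA := sub_aff Ay.
set w := (X in relint A X).
have wA : aff A w by exact: aff_affine.
apply/relintP; split => //; exists ((1 - t) * e); first exact: mulr_gt0.
move=> u uA wu.
pose q := p + (1 - t)^-1 *: (u - w).
have qA : aff A q by exact: aff_parallelogram.
have -> : u = (1 - t) *: q + t *: y.
  by rewrite /q /w; vec_field; rewrite gt_eqF.
apply: convex_comb => //; last by rewrite t0 ltW.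
apply: eA => //.
have -> : p - q = (1 - t)^-1 *: (w - u).
  by rewrite /q; vec_field; rewrite gt_eqF.
by rewrite normrZ gtr0_norm ?invr_gt0// mulrC ltr_pdivrMr// mulrC.
Qed.

Lemma relint_subset A B : A `<=` B -> aff A = aff B -> relint A `<=` relint B.
Proof.
move=> AB eAB x /relintP[xA [e e0 eA]]; apply/relintP; split.
  by rewrite -eAB.
by exists e => // y yB xy; apply/AB/eA => //; rewrite eAB.
Qed.
End ConvexGeometry.

(** * Nonempty convex sets have relative interior points *)

Section RelintNonempty.
Context {R : realType} {V : normedVectType R}.
Implicit Types (A K : set V).

(** Compactness of the unit sphere of coordinates: the norm of the combination
    is continuous there and never zero, so it has a positive minimum. It makes
    the coordinates of a point continuous. *)
Lemma free_coord_bound n (v : n.-tuple V) : free v ->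
  exists2 c : R, 0 < c &
    forall a : 'rV[R]_n, c * `|a| <= `|\sum_(i < n) a 0 i *: v`_i|.
Proof.
move=> fv.
pose L (a : 'rV[R]_n) := \sum_(i < n) a 0 i *: v`_i.
pose S := [set a : 'rV[R]_n | `|a| = 1].
have LZ t a : L (t *: a) = t *: L a.
  by rewrite /L scaler_sumr; apply: eq_bigr => i _; rewrite mxE scalerA.
have cL : continuous (fun a => `|L a|).
  move=> a; apply: continuous_comp; last exact: norm_continuous.
  apply: (continuous_big (@add_continuous V)) => i _ b.
  exact: (cvgZr_tmp (@coord_continuous R 1 n 0 i b)).
have cptS : compact S.
  apply: bounded_closed_compact.
    by exists 1; split => // M M1 a /= ->; exact: ltW.
  rewrite (_ : S = (fun a : 'rV[R]_n => `|a|) @^-1` [set 1])//.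
  apply: preimage_closed; last exact: closed_eq.
  by move=> a _; exact: norm_continuous.
(* For n = 0 the sphere is empty, but then every a is zero. *)
have [[a0 Sa0]|S0] := pselect (S !=set0); last first.
  exists 1 => // a; have [->|a_neq0] := eqVneq a 0.
    by rewrite normr0 mulr0.
  exfalso; apply: S0; exists (`|a|^-1 *: a).
  by rewrite /S/= normrZ normfV normr_id mulVf// normr_eq0.
have [b Sb bmin] := compact_EVT_min (ex_intro _ a0 Sa0) cptS
  (continuous_subspaceT cL).
exists `|L b|.
  rewrite normr_gt0; apply/eqP => Lb0.
  have b0 : b = 0.
    apply/rowP => i; rewrite mxE.
    exact: (elimT freeP fv (fun i => b 0 i) Lb0).
  by move: Sb; rewrite inE /S/= b0 normr0 => /eqP; rewrite eq_sym oner_eq0.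
move=> a; have [->|a_neq0] := eqVneq a 0.
  by rewrite normr0 mulr0.
have Sa : S (`|a|^-1 *: a).
  by rewrite /S/= normrZ normfV normr_id mulVf// normr_eq0.
have := bmin _ (mem_set Sa); rewrite LZ normrZ normfV normr_id mulrC.
by rewrite ler_pdivlMr// normr_gt0.
Qed.

(** The combination is stated as a multiple of a point of K, and not divided by
    the sum of the coefficients, so that vanishing coefficients are covered. *)
Lemma convex_conic_sum K n (v : nat -> V) (c : nat -> R) :
  convex_set K -> K 0 -> (forall i, (i < n)%N -> K (v i)) ->
  (forall i, (i < n)%N -> 0 <= c i) ->
  exists2 k, K k & \sum_(i < n) c i *: v i = (\sum_(i < n) c i) *: k.
Proof.
move=> cK K0; elim: n => [|n IH] Kv c0.
  by exists 0 => //; rewrite !big_ord0 scale0r.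
have [i ni|i ni|k Kk ksum] := IH.
- exact/Kv/leqW.
- exact/c0/leqW.
rewrite !big_ord_recr/= ksum; set s := \sum_(i < n) c i.
have s0 : 0 <= s by apply: sumr_ge0 => i _; exact/c0/leqW.
have cn0 : 0 <= c n by exact: c0.
have [sc0|sc_neq0] := eqVneq (s + c n) 0.
  exists 0 => //; rewrite sc0.
  have -> : s = 0 by lra.
  have -> : c n = 0 by lra.
  by rewrite !scale0r addr0.
have sc_gt0 : 0 < s + c n by rewrite lt_def sc_neq0 addr_ge0.
exists ((1 - c n / (s + c n)) *: k + (c n / (s + c n)) *: v n).
  apply: convex_comb => //; first exact: Kv.
  by rewrite divr_ge0 ?(ltW sc_gt0)//= ler_pdivrMr// mul1r lerDr.
by vec_field.
Qed.

(** Take a maximal linearly independent family of vectors s_i = y_i - x0 with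
    y_i in K. It spans the direction of aff K, so near the barycentre p of the
    simplex with vertices x0 and y_i the points of aff K have positive
    barycentric coordinates, hence lie in K. *)
Lemma relint_nonempty K : convex_set K -> K !=set0 -> relint K !=set0.
Proof.
move=> cK [x0 Kx0].
pose D := [set x - x0 | x in K].
pose P n := `[< exists s : seq V,
  [/\ free s, {in s, forall v, D v} & size s = n] >].
have P0 : exists n, P n.
  by exists 0%N; apply/asboolP; exists [::]; split=> //; exact: nil_free.
have Pb n : P n -> (n <= \dim {:V})%N.
  by move=> /asboolP[s [fs _ <-]]; rewrite -(eqP fs) dimvS// subvf.
have [n /asboolP[s [fs Ds sn]] nmax] := ex_maxnP P0 Pb.
have spanD v : D v -> v \in span s.
  move=> Dv; apply: contrapT => /negP vs.
  have /nmax : P n.+1.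
    apply/asboolP; exists (v :: s); rewrite free_cons vs fs /= sn; split=> //.
    by move=> w; rewrite inE => /predU1P[->//|]; exact: Ds.
  by rewrite ltnn.
have affK x : aff K x -> x - x0 \in span s.
  apply: (@affine_subset _ _ K [set x | x - x0 \in span s]).
    move=> y z t /= hy hz.
    have -> : (1 - t) *: y + t *: z - x0 = (1 - t) *: (y - x0) + t *: (z - x0).
      by vec_field.
    by rewrite memvD// memvZ.
  by move=> y Ky /=; apply: spanD; exists y.
have cD : convex_set D.
  move=> _ _ l /set_mem[y Ky <-] /set_mem[z Kz <-]; apply/mem_set.
  exists (l%:num *: y + (1 - l%:num) *: z); last first.
    rewrite -[RHS]/(l%:num *: (y - x0) + (1 - l%:num) *: (z - x0)).
    by vec_field.
  exact: (set_mem (cK y z l (mem_set Ky) (mem_set Kz))).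
have D0 : D 0 by exists x0 => //; rewrite subrr.
have [c c0 cP] := @free_coord_bound _ (in_tuple s) fs.
pose N : R := (size s).+1%:R.
have N0 : 0 < N by rewrite ltr0n.
pose p := x0 + \sum_(i < size s) N^-1 *: s`_i.
have inD (a : 'I_(size s) -> R) : (forall i, 0 <= a i) ->
    \sum_i a i <= 1 -> D (\sum_i a i *: s`_i).
  move=> a0 a1.
  pose b j := if insub j is Some i then a i else 0.
  have bE (i : 'I_(size s)) : b i = a i by rewrite /b valK.
  have [i si|i si|k Dk] := @convex_conic_sum D (size s) (nth 0 s) b cD D0.
  - by apply: Ds; rewrite mem_nth.
  - by rewrite /b; case: insubP.
  under eq_bigr do rewrite bE.
  under [in RHS]eq_bigr do rewrite bE.
  move=> ->; have -> : (\sum_i a i) *: k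
      = (1 - \sum_i a i) *: 0 + (\sum_i a i) *: k.
    by rewrite scaler0 add0r.
  by apply: convex_comb => //; rewrite sumr_ge0.
have sumN : \sum_(i < size s) N^-1 = 1 - N^-1.
  rewrite sumr_const card_ord -mulr_natl.
  have -> : (size s)%:R = N - 1 by rewrite /N -natr1 addrK.
  by field; rewrite gt_eqF.
have inK w : D w -> K (x0 + w) by case=> y Ky <-; rewrite addrC subrK.
have Kp : K p.
  apply/inK/inD; first by move=> _; rewrite invr_ge0 ltW.
  by rewrite sumN gerBl invr_ge0 ltW.
exists p; apply/relintP; split; first exact: sub_aff.
(* Each of the coordinates of p is N^-1. Perturbing all of them by less than
   N^-2 keeps them positive, and their sum below (1 - N^-1) (1 + N^-1) < 1. *)
exists (c * N^-1 ^+ 2); first by rewrite mulr_gt0// exprn_gt0// invr_gt0.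
move=> y /affK ys py.
have yE := @coord_span _ _ _ (in_tuple s) _ ys.
pose a := \row_i (N^-1 - coord (in_tuple s) i (y - x0)).
have pyE : p - y = \sum_i a 0 i *: s`_i.
  have -> : p - y = \sum_(i < size s) N^-1 *: s`_i - (y - x0).
    rewrite /p; by vec_field.
  rewrite [in LHS]yE -sumrB; apply: eq_bigr => i _.
  by rewrite mxE scalerBl.
have aN : `|a| < N^-1 ^+ 2.
  by rewrite -(ltr_pM2l c0); apply: le_lt_trans py; rewrite pyE.
have aiN i : `|a 0 i| < N^-1 ^+ 2.
  apply: le_lt_trans aN; rewrite [leRHS]/Num.Def.normr/= mx_normrE.
  by apply/bigmax_geP; right; exists (0, i).
have N1 : N^-1 <= 1 by rewrite invf_le1// ler1n.
have coordE i : coord (in_tuple s) i (y - x0) = N^-1 - a 0 i.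
  by rewrite mxE opprB addrCA subrr addr0.
rewrite -[y](subrK x0) addrC; apply: inK; rewrite yE; apply: inD => [i|].
  rewrite coordE subr_ge0; apply: le_trans (ler_norm _) _.
  apply: le_trans (ltW (aiN i)) _.
  by rewrite expr2 ler_piMl// invr_ge0 ltW.
under eq_bigr do rewrite coordE.
rewrite sumrB sumN -sumrN.
have : \sum_i - a 0 i <= \sum_(i < size s) N^-1 ^+ 2.
  apply: ler_sum => i _; apply: le_trans (ltW (aiN i)).
  by rewrite -normrN ler_norm.
rewrite sumr_const card_ord -mulr_natl expr2 mulrA.
rewrite (_ : (size s)%:R * N^-1 = 1 - N^-1); last first.
  by rewrite -sumN sumr_const card_ord mulr_natl.
move: (\sum_i _) => S leS; have := sqr_ge0 N^-1; rewrite expr2.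
by move: leS; move: (N^-1) => q; nra.
Qed.
End RelintNonempty.

(** * Affine dimension *)

Section AffineDimension.
Context {R : realType} {V : normedVectType R}.
Implicit Types (A B : set V).

Lemma aff_subset A B : A `<=` B -> aff A `<=` aff B.
Proof.
move=> AB; apply: affine_subset; first exact: aff_affine.
by move=> x /AB; exact: sub_aff.
Qed.

Lemma affine_dim_neq0 A : A !=set0 -> affine_dim A = (\dim (direction A))%:Z.
Proof.
by case=> a Aa; rewrite /affine_dim; case: asboolP => // A0; rewrite A0 in Aa.
Qed.

Lemma aff_eq_dim A B : A !=set0 -> B !=set0 -> aff A = aff B ->
  affine_dim A = affine_dim B.
Proof. by move=> A0 B0 eAB; rewrite !affine_dim_neq0// /direction eAB. Qed.

Lemma dim_eq_aff A B : A `<=` B -> A !=set0 ->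
  affine_dim A = affine_dim B -> aff A = aff B.
Proof.
move=> AB [a Aa].
have A0 : A !=set0 by exists a.
have B0 : B !=set0 by exists a; exact: AB.
rewrite !affine_dim_neq0// => -[dAB].
have sAB := aff_subset AB.
have DAB : direction A = direction B.
  apply/eqP; rewrite eqEdim dAB leqnn andbT; apply/subvP => v vA.
  have : [set` direction A] v by [].
  rewrite directionE// => -[x xA [y yA <-]].
  have : [set x - y | x in aff B & y in aff B] (x - y).
    by exists x; [exact: sAB|exists y => //; exact: sAB].
  by rewrite -directionE.
apply/seteqP; split=> // x xB.
have : [set x - y | x in aff B & y in aff B] (x - a).
  by exists x => //; exists a => //; apply: sub_aff; exact: AB.
rewrite -directionE// -DAB directionE// => -[y yA [z zA yz]].
have -> : x = a + 1 *: (y - z) by rewrite yz scale1r addrC subrK.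
exact: aff_parallelogram (sub_aff Aa) zA yA.
Qed.
End AffineDimension.

(** * Radial projection onto the relative boundary *)

Section RadialProjection.
Context {R : realType} {V : normedVectType R}.
Variables (X : set V) (p : V).
Hypotheses (cptX : compact X) (convX : convex_set X) (pX : relint X p).
Implicit Types (x y : V) (s : R).

Definition dilations x : set R := [set s | 0 < s /\ X (p + s^-1 *: (x - p))].

(** The Minkowski gauge of X - p at x - p. *)
Definition gauge x : R := inf (dilations x).

Definition radial_proj x : V := p + (gauge x)^-1 *: (x - p).

Let Xp : X p. Proof. exact: relint_sub. Qed.

Lemma gauge_le x s : dilations x s -> gauge x <= s.
Proof. by move=> xs; apply: ge_inf => //; exists 0 => r [/ltW]. Qed.

Lemma dilations1 x : X x -> dilations x 1.
Proof. by move=> Xx; split => //; rewrite invr1 scale1r addrC subrK. Qed.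

Lemma gauge_ge x (c : R) : X x -> (forall s, dilations x s -> c <= s) ->
  c <= gauge x.
Proof. by move=> /dilations1 x1 xc; apply: lb_le_inf => //; exists 1. Qed.

Lemma dilations_upward x s s' : dilations x s -> s <= s' -> dilations x s'.
Proof.
move=> [s0 Xs] ss'; have s'0 := lt_le_trans s0 ss'; split => //.
have -> : p + s'^-1 *: (x - p)
    = (1 - s / s') *: p + (s / s') *: (p + s^-1 *: (x - p)).
  by vec_field; rewrite !gt_eqF.
apply: convex_comb => //.
by rewrite divr_ge0 ?(ltW s0) ?(ltW s'0)//= ler_pdivrMr// mul1r.
Qed.

(** X is bounded, so it contains no ray from p. *)
Lemma gauge_gt0 x : X x -> x != p -> 0 < gauge x.
Proof.
move=> Xx xp.
have [M M0 XM] : exists2 M : R, 0 < M & forall y, X y -> `|y - p| <= M.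
  have /pinfty_ex_gt0[M M0 XM] := compact_bounded cptX.
  exists (M + M) => [|y Xy]; first exact: addr_gt0.
  by apply: le_trans (ler_normB _ _) _; apply: lerD; exact: XM.
apply: (@lt_le_trans _ _ (`|x - p| / M)).
  by rewrite divr_gt0// normr_gt0 subr_eq0.
apply: gauge_ge => // s [s0 /XM].
rewrite [p + _]addrC addrK normrZ gtr0_norm ?invr_gt0//.
by rewrite mulrC !ler_pdivrMr// mulrC.
Qed.

Lemma gauge_le1 x : X x -> gauge x <= 1.
Proof. by move=> /dilations1/gauge_le. Qed.

(** Every s > gauge x is a dilation factor; the projection is the limit of the
    points they give as s decreases to the gauge, and X is closed. *)
Lemma radial_proj_in x : X x -> x != p -> X (radial_proj x).
Proof.
move=> Xx xp; have g0 := gauge_gt0 Xx xp.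
have clX : closed X by apply: compact_closed => //; exact: norm_hausdorff.
have lim : p + s^-1 *: (x - p) @[s --> (gauge x)^'+] --> radial_proj x.
  apply: cvgD; first exact: cvg_cst.
  apply: cvgZr_tmp; apply: cvgV; first by rewrite gt_eqF.
  exact: cvg_at_right_filter.
apply: (closed_cvg X clX _ _ lim).
near=> s.
have gs : gauge x < s by near: s; exact: nbhs_right_gt.
have [r xr rs] : exists2 r, dilations x r & r < s.
  have [||r xr] := @inf_adherent _ (dilations x) (s - gauge x).
  - by rewrite subr_gt0.
  - by split; [exists 1; exact: dilations1|exists 0 => r [/ltW]].
  - by rewrite -/(gauge x) addrC subrK => rs; exists r.
by have [] := dilations_upward xr (ltW rs).
Unshelve. all: by end_near. Qed.

Lemma relint_gauge_lt1 x s : dilations x s -> s < 1 -> relint X x.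
Proof.
move=> [s0 Xs] s1.
have -> : x = (1 - s) *: p + s *: (p + s^-1 *: (x - p)).
  by vec_field; rewrite gt_eqF.
by apply: relint_comb => //; rewrite ltW.
Qed.

(** A dilation factor s < 1 would put x strictly between p and a point of X, in
    the relative interior. *)
Lemma gauge_relboundary x : relboundary X x -> gauge x = 1.
Proof.
move=> [Xx xX]; apply/eqP; rewrite eq_le gauge_le1//=.
apply: gauge_ge => // s xs; rewrite leNgt; apply/negP => s1.
exact: xX (relint_gauge_lt1 xs s1).
Qed.

Lemma radial_proj_id x : relboundary X x -> radial_proj x = x.
Proof.
move=> /gauge_relboundary g1.
by rewrite /radial_proj g1 invr1 scale1r addrC subrK.
Qed.

(** From a relative interior point one could go a little further away from p
    within X, which would give a dilation factor below the gauge. *)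
Lemma radial_proj_relboundary x : X x -> x != p ->
  relboundary X (radial_proj x).
Proof.
move=> Xx xp; split; first exact: radial_proj_in.
have g0 := gauge_gt0 Xx xp.
move=> /relintP[yX [e e0 eX]].
have xp0 : 0 < `|x - p| by rewrite normr_gt0 subr_eq0.
pose d := e / 2 / `|x - p|.
have d0 : 0 < d by rewrite !divr_gt0.
have gd0 : 0 < (gauge x)^-1 + d by rewrite addr_gt0// invr_gt0.
have : dilations x ((gauge x)^-1 + d)^-1.
  split; first by rewrite invr_gt0.
  rewrite invrK scalerDl addrA -/(radial_proj x); apply: eX.
    by apply: aff_parallelogram => //; exact: sub_aff.
  rewrite opprD addrA subrr sub0r normrN normrZ gtr0_norm// /d.
  by rewrite divfK ?gt_eqF//; lra.
move=> /gauge_le; apply/negP; rewrite -ltNge.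
rewrite -[ltRHS]invrK ltf_pV2 ?posrE ?invr_gt0//.
by rewrite ltrDl.
Qed.

(** The gauge is subadditive, and along aff X it is at most 1 / r times the norm
    when X contains the relative ball of radius r about p. *)
Lemma gauge_lipschitz : exists2 k : R, 0 < k &
  forall x y, X x -> X y -> `|gauge x - gauge y| <= k * `|x - y|.
Proof.
have /relintP[pA [e e0 eX]] := pX.
(* The constant for the radius e / 2: a point of aff X at distance exactly e
   from p need not be in X. *)
have k0 : 0 < 2 / e by rewrite divr_gt0.
have half x y : X x -> X y -> gauge y <= gauge x + 2 / e * `|y - x|.
  move=> Xx Xy; have [->|yx] := eqVneq y x.
    by rewrite subrr normr0 mulr0 addr0.
  have yx0 : 0 < `|y - x| by rewrite normr_gt0 subr_eq0.
  pose d := 2 / e * `|y - x|.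
  have d0 : 0 < d by rewrite mulr_gt0.
  rewrite -/d -lerBlDr; apply: gauge_ge => // s [s0 Xs]; rewrite lerBlDr.
  apply: gauge_le; split; first exact: addr_gt0.
  have sd0 : 0 < s + d by exact: addr_gt0.
  have -> : p + (s + d)^-1 *: (y - p)
    = (1 - d / (s + d)) *: (p + s^-1 *: (x - p))
      + (d / (s + d)) *: (p + d^-1 *: (y - x)).
    by vec_field; rewrite !gt_eqF.
  apply: convex_comb => //.
    apply: eX.
      by apply: aff_parallelogram => //; exact: sub_aff.
    rewrite opprD addrA subrr sub0r normrN normrZ gtr0_norm ?invr_gt0//.
    rewrite mulrC ltr_pdivrMr//.
    have -> : e * d = 2 * `|y - x| by rewrite /d; field; rewrite gt_eqF.
    by lra.
  by rewrite divr_ge0 ?(ltW d0) ?(ltW sd0)//= ler_pdivrMr// mul1r lerDr ltW.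
exists (2 / e) => // x y Xx Xy; rewrite ler_norml.
have := half _ _ Xx Xy; have := half _ _ Xy Xx; rewrite (distrC y x); lra.
Qed.

Lemma radial_proj_cvg (T : Type) (F : set_system T) {FF : Filter F}
    (h : T -> V) x :
  X x -> x != p -> (\forall t \near F, X (h t)) -> h @ F --> x ->
  radial_proj \o h @ F --> radial_proj x.
Proof.
move=> Xx xp Xh hx; have [k k0 kL] := gauge_lipschitz.
apply: cvgD; first exact: cvg_cst.
apply: cvgZ; last by apply: cvgB => //; exact: cvg_cst.
apply: cvgV; first by rewrite gt_eqF// gauge_gt0.
apply/cvgrPdist_le => e e0.
have : \forall t \near F, `|x - h t| <= e / k.
  by move/cvgrPdist_le : hx; apply; rewrite divr_gt0.
apply: filterS2 Xh => t Xht; rewrite ler_pdivlMr// mulrC.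
by apply: le_trans; exact: kL.
Qed.
End RadialProjection.

(** * Pointwise convergence *)

Section MappingSpaces.
Context {R : realType} {U W : normedVectType R}.
Variable Z : set W.
Implicit Types (D : set {ptws Z -> U}) (E : set U) (g : {ptws Z -> U}) (z : Z).

Lemma eval_continuous z : continuous (fun g => g z : U).
Proof. exact: (@proj_continuous _ (fun _ : Z => U) z). Qed.

Lemma cvg_ptws {T : Type} (F : set_system T) {FF : Filter F}
    (H : T -> {ptws Z -> U}) g :
  (forall z, (fun y => H y z) @ F --> g z) -> H @ F --> g.
Proof. by move=> Hz; apply/pointwise_cvgP. Qed.

Lemma cvg_eval {T : Type} (F : set_system T) {FF : Filter F}
    (H : T -> {ptws Z -> U}) g z :
  H @ F --> g -> (fun y => H y z : U) @ F --> (g z : U).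
Proof.
move=> Hg; apply: (@cvg_comp _ _ _ H (fun k : {ptws Z -> U} => k z) F
  (nbhs g) (nbhs (g z : U))).
  exact: Hg.
exact: eval_continuous.
Qed.

Lemma cvg_comb {T : Type} (F : set_system T) {FF : Filter F}
    (a : T -> R) (u v : T -> U) (a0 : R) (u0 v0 : U) :
  a @ F --> a0 -> u @ F --> u0 -> v @ F --> v0 ->
  (1 - a y) *: u y + a y *: v y @[y --> F] --> (1 - a0) *: u0 + a0 *: v0.
Proof.
move=> ha hu hv; apply: cvgD; apply: cvgZ => //.
by apply: cvgB => //; exact: cvg_cst.
Qed.

Lemma closure_sub_preimage (S T : topologicalType) (D : set S) (E : set T)
    (phi : S -> T) :
  continuous phi -> closed E -> (forall x, D x -> E (phi x)) ->
  forall x, closure D x -> E (phi x).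
Proof.
move=> cphi clE DE x Dx.
have clP : closed (phi @^-1` E) by apply: preimage_closed => // y _; exact: cphi.
by apply: clP; apply: closureS Dx => y /DE.
Qed.
End MappingSpaces.

(** * Affine maps on a convex set *)

Section AffineMaps.
Context {R : realType} {U W : normedVectType R}.
Variable Z : set W.
Hypothesis convZ : convex_set Z.
Implicit Types (X : set U) (g : Z -> U).

Lemma convex_point (a b : Z) (t : R) : 0 <= t <= 1 ->
  exists c : Z, \val c = (1 - t) *: \val a + t *: \val b.
Proof.
move=> t01.
have hc := convex_comb convZ (set_valP a) (set_valP b) t01.
by exists (SigSub (mem_set hc)).
Qed.

Lemma convex_range g : affine_map g -> convex_set (range g).
Proof.
move=> ag _ _ l /set_mem[a _ <-] /set_mem[b _ <-]; apply/mem_set.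
have l01 : 0 <= (l%:num : R) <= 1 by apply/andP; split.
have [c cE] := convex_point b a l01.
by exists c => //; rewrite (ag _ _ _ _ l01 cE) addrC.
Qed.

Lemma affine_map_cst (x : U) : affine_map (fun _ : Z => x).
Proof. by move=> a b c t _ _; vec_field. Qed.

Lemma affine_map_comb (g h : Z -> U) (s : R) : affine_map g -> affine_map h ->
  affine_map (fun z => (1 - s) *: g z + s *: h z).
Proof.
move=> ag ah a b c t t01 cE.
by rewrite (ag _ _ _ _ t01 cE) (ah _ _ _ _ t01 cE); vec_field.
Qed.

Lemma affine_hom_comb X g h (s : R) : convex_set X -> 0 <= s <= 1 ->
  affine_hom Z X g -> affine_hom Z X h ->
  affine_hom Z X (fun z => (1 - s) *: g z + s *: h z).
Proof.
move=> cX s01 [ag gX] [ah hX]; split; first exact: affine_map_comb.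
by move=> _ [z _ <-]; apply: convex_comb => //; [apply: gX|apply: hX]; exists z.
Qed.

Lemma affine_hom_cst X (x : U) : X x -> affine_hom Z X (fun _ => x).
Proof. by move=> Xx; split; [exact: affine_map_cst|move=> _ [z _ <-]]. Qed.

Lemma affine_hom_closed X : closed X -> closed (affine_hom Z X).
Proof.
move=> clX g clg; split.
  move=> a b c t t01 cE; apply/eqP; rewrite -subr_eq0; apply/eqP.
  pose phi (h : {ptws Z -> U}) := h c - ((1 - t) *: h a + t *: h b).
  have cphi : continuous phi.
    move=> h; apply: (@cvgB _ U _ (nbhs h) _ (fun k : {ptws Z -> U} => k c)
      (fun k : {ptws Z -> U} => (1 - t) *: k a + t *: k b)).
      exact: eval_continuous.
    by apply: cvg_comb; [exact: cvg_cst|exact: eval_continuous..].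
  apply: (@closure_sub_preimage _ _ (affine_hom Z X) [set 0] phi cphi _ _ g
    clg).
  - exact/accessible_closed_set1/hausdorff_accessible/norm_hausdorff.
  - by move=> h [ah _] /=; rewrite /phi (ah _ _ _ _ t01 cE) subrr.
move=> _ [z _ <-].
apply: (@closure_sub_preimage _ _ (affine_hom Z X) X
  (fun h : {ptws Z -> U} => h z) (@eval_continuous _ _ _ Z z) clX _ g clg).
by move=> h [_]; apply; exists z.
Qed.
End AffineMaps.

(** * Affine maps that avoid a relative interior *)

Section RelintAvoidance.
Context {R : realType} {U W : normedVectType R}.
Variables (X I : set U) (Z : set W).
Hypotheses (convX : convex_set X) (convZ : convex_set Z) (convI : convex_set I).
Implicit Types (p q x : U) (g : {ptws Z -> U}).

Definition hom_avoiding : set {ptws Z -> U} :=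
  [set g | affine_hom Z X g /\ range g `&` relint I = set0].

Lemma hom_avoidingP g :
  hom_avoiding g <-> affine_hom Z X g /\ forall z, ~ relint I (g z).
Proof.
split=> -[gX gI]; split => //.
  by move=> z Igz; have : set0 (g z) by rewrite -gI; split => //; exists z.
by rewrite -subset0 => _ [[z _ <-]]; exact: gI.
Qed.

Lemma hom_avoiding_cst x : X x -> ~ relint I x -> hom_avoiding (cst x).
Proof.
by move=> Xx Ix; apply/hom_avoidingP; split => //; exact: affine_hom_cst.
Qed.

(** The second set is open in the ambient space, so lying outside it is a closed
    condition on the values of a map. *)
Lemma relintE : relint I = aff I `&` (~` aff I `|` I)°.
Proof.
apply/seteqP; split=> x.
  move=> /relintP[xI [e e0 eI]]; split => //; apply/nbhs_ballP.
  exists e => // y.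
  rewrite -ball_normE /= => xy; have [yI|] := pselect (aff I y); last by left.
  by right; exact: eI.
case=> xI /nbhs_ballP[e /= e0 eI]; apply/relintP; split => //; exists e => //.
move=> y yI xy.
by have [|//|//] := eI y; rewrite -ball_normE.
Qed.

(** The values of a map in Hom(Z, X) lie in aff I, where the relative interior
    of I is open. *)
Lemma hom_avoiding_closed : closed X -> X `<=` aff I -> closed hom_avoiding.
Proof.
move=> clX XI g clg; apply/hom_avoidingP; split.
  by apply: affine_hom_closed => //; apply: closureS clg => h [].
move=> z; rewrite relintE => -[_].
apply: (@closure_sub_preimage _ _ hom_avoiding (~` (~` aff I `|` I)°)
  (fun h => h z) (@eval_continuous _ _ _ Z z) _ _ g clg).
  exact/open_closedC/open_interior.
move=> h /hom_avoidingP[[_ hX] hI] zI; apply: (hI z); rewrite relintE.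
by split => //; apply: XI; apply: hX; exists z.
Qed.

Lemma relint_convex p x (s : R) : relint I p -> relint I x -> 0 <= s <= 1 ->
  relint I ((1 - s) *: p + s *: x).
Proof.
move=> Ip Ix /andP[s0]; rewrite le_eqVlt => /predU1P[->|s1].
  by rewrite subrr scale0r scale1r add0r.
by apply: relint_comb => //; [exact: relint_sub|rewrite s0].
Qed.

(** Here p + r (g z0 - p) is g z0 pushed away from p. If the combination y of it
    with g z were in relint I, so would be every point between p and y. The
    segment from p to y crosses the segment from g z to g z0, which is part
    of the image of g. *)
Lemma push_away_avoids g p (z0 z : Z) (r t : R) :
  relint I p -> affine_map g -> (forall z, ~ relint I (g z)) ->
  1 <= r -> 0 <= t <= 1 ->
  ~ relint I ((1 - t) *: g z + t *: (p + r *: (g z0 - p))).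
Proof.
move=> Ip ag gI r1 /andP[t0 t1] Iy.
(* In (1 - s) p + s y the coefficient of p is 1 - s d, so s = d^-1 is the
   parameter of the crossing point. *)
pose d := 1 + t * (r - 1).
have tr0 : 0 <= t * (r - 1) by rewrite mulr_ge0// subr_ge0.
have d0 : 0 < d by rewrite ltr_wpDr.
have s01 : 0 <= t * r / d <= 1.
  rewrite divr_ge0 ?(ltW d0) ?mulr_ge0//=; last exact: le_trans r1.
  by rewrite ler_pdivrMr// /d; lra.
have [c cE] := convex_point convZ z z0 s01.
apply: (gI c); rewrite (ag _ _ _ _ s01 cE).
have -> : (1 - t * r / d) *: g z + (t * r / d) *: g z0
    = (1 - d^-1) *: p + d^-1 *: ((1 - t) *: g z + t *: (p + r *: (g z0 - p))).
  by rewrite /d; vec_field; rewrite gt_eqF.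
apply: relint_convex => //.
by rewrite invr_ge0 (ltW d0)/= invf_le1// /d lerDl.
Qed.

End RelintAvoidance.
Arguments hom_avoiding {R U W} X I Z.

(** * The two homotopies *)

Section Homotopies.
Context {R : realType} {U W : normedVectType R}.
Variables (X I : set U) (Z : set W) (z0 : Z).
Hypotheses (cptX : compact X) (convX : convex_set X) (convZ : convex_set Z).
Hypotheses (convI : convex_set I) (IX : I `<=` X).
Local Notation maps := {ptws Z -> U}.
Local Notation C := (closure (hom_avoiding X I Z)).

Lemma within_ptws_continuous (B : set (R * maps)) (H : R * maps -> maps) :
  (forall y z, B y -> (fun y' => H y' z) @ within B (nbhs y) --> H y z) ->
  {within B, continuous H}.
Proof.
move=> Hc; apply/subspace_continuousP => y By.
by apply: cvg_ptws => z; exact: Hc.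
Qed.

Let clX : closed X.
Proof. by apply: compact_closed => //; exact: norm_hausdorff. Qed.

(** Straight-line homotopy from g to the constant map at the radial projection
    of g z0 from a point p of relint I. It never meets p, as g avoids
    relint I. *)
Lemma relboundary_retract : I !=set0 -> aff I = aff X ->
  strong_deformation_retract R
    [set (cst x : maps) | x in relboundary X] (hom_avoiding X I Z).
Proof.
move=> I0 eIX.
have [p Ip] := relint_nonempty convI I0.
have sIX := relint_subset IX eIX.
have Xp := sIX _ Ip.
split.
  by move=> _ [x [Xx bx] <-]; apply: hom_avoiding_cst => // /sIX.
pose rho := radial_proj X p.
exists (fun y => (fun z => (1 - y.1) *: y.2 z + y.1 *: rho (y.2 z0)) : maps).
have Cz0 g : hom_avoiding X I Z g -> X (g z0) /\ g z0 != p.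
  move=> /hom_avoidingP[[_ gX] gI]; split; first by apply: gX; exists z0.
  by apply/eqP => gp; apply: (gI z0); rewrite gp.
split.
- apply: within_ptws_continuous => -[t g] z [/= _ Cg].
  set F := within _ _; have FF : Filter F by exact: within_filter.
  have [Xg gp] := Cz0 _ Cg.
  have t_cvg : fst @ F --> t by apply: cvg_within_filter; exact: cvg_fst.
  have g_cvg : snd @ F --> g by apply: cvg_within_filter; exact: cvg_snd.
  apply: cvg_comb.
  - exact: t_cvg.
  - exact: (cvg_eval g_cvg).
  apply: (radial_proj_cvg (h := fun y : R * maps => y.2 z0) cptX convX Xp) => //.
    rewrite /F; near=> y.

    have [_ /Cz0[]//] : (`[0, 1] `*` hom_avoiding X I Z) y.
    by near: y; exact: withinT.
  exact: (cvg_eval g_cvg).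
- move=> t g; rewrite in_itv/= => t01 Cg.
  have [Xg gp] := Cz0 _ Cg.
  move/hom_avoidingP : Cg => [gX gI]; apply/hom_avoidingP; split.
    apply: affine_hom_comb => //; apply: affine_hom_cst.
    exact: radial_proj_in.
  move=> z; apply: push_away_avoids => //; first exact: gX.1.
  by rewrite invf_ge1 ?gauge_le1 ?gauge_gt0.
- by move=> g _ /=; apply/funext => z; rewrite subr0 scale1r scale0r addr0.
- move=> g /Cz0[Xg gp]; exists (rho (g z0)).
    exact: radial_proj_relboundary.
  by apply/funext => z /=; rewrite subrr scale0r scale1r add0r.
- move=> t _ _ [x bx <-] /=; apply/funext => z /=.
  by rewrite /rho radial_proj_id//; vec_field.
Unshelve. all: by end_near. Qed.

Section LowDimensional.
Variable q : U.
Hypotheses (Xq : X q) (affq : ~ aff I q).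

(** If x is in aff I, the points (1 - s) x + s q with 0 < s lie outside aff I,
    since with x they would otherwise span q; let s tend to 0. *)
Lemma cst_avoiding_closure x : X x -> C (cst x).
Proof.
move=> Xx; have [Ix|Ix] := pselect (aff I x); last first.
  apply: subset_closure; apply: hom_avoiding_cst => // /relint_sub Iq.
  exact: Ix (sub_aff Iq).
pose u (s : R) : maps := cst ((1 - s) *: x + s *: q).
have ux : u s @[s --> 0^'+] --> (cst x : maps).
  have ux0 : (1 - s) *: x + s *: q @[s --> (0 : R)] --> (1 - 0) *: x + 0 *: q.
    by apply: (cvg_comb (a := id)); [exact: cvg_id|exact: cvg_cst..].
  rewrite subr0 scale1r scale0r addr0 in ux0.
  by apply: cvg_ptws => z; exact: cvg_at_right_filter ux0.
apply: (closed_cvg C (@closed_closure _ _) _ _ ux).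
near=> s.
have s0 : 0 < s by near: s; exact: nbhs_right_gt.
have s1 : s < 1 by near: s; exact: nbhs_right_lt.
apply: subset_closure; apply: hom_avoiding_cst.
  by apply: convex_comb => //; rewrite !ltW.
move=> /relint_sub/sub_aff Iw; apply: affq.
have -> : q = x + s^-1 *: ((1 - s) *: x + s *: q - x).
  by vec_field; rewrite gt_eqF.
exact: aff_parallelogram.
Unshelve. all: by end_near. Qed.

Definition shrink (a : R) (g : maps) : maps :=
  fun z => (1 - a) *: g z + a *: g z0.

Lemma shrink_continuous (a : R) : continuous (shrink a).
Proof.
move=> g.
apply: (@cvg_ptws R U W Z maps (nbhs g) _ (shrink a) (shrink a g)) => z.
rewrite /shrink.
apply: (cvg_comb (a := fun=> a) (u := fun k : maps => k z)
  (v := fun k : maps => k z0)); first exact: cvg_cst.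
  exact: eval_continuous.
exact: eval_continuous.
Qed.

(** By affinity the shrunk map takes its values in the image of g. So shrinking
    preserves the maps that avoid relint I, and, being continuous, their
    closure. *)
Lemma shrink_avoiding (a : R) g : 0 <= a <= 1 -> C g -> C (shrink a g).
Proof.
move=> a01; apply: (closure_sub_preimage (@shrink_continuous a)).
  exact: closed_closure.
move=> {}g /hom_avoidingP[gX gI]; apply/subset_closure/hom_avoidingP; split.
  apply: affine_hom_comb => //; apply: affine_hom_cst.
  by apply: gX.2; exists z0.
move=> z; have [c cE] := convex_point convZ z z0 a01.
by rewrite /shrink -(gX.1 _ _ _ _ a01 cE).
Qed.

(** The parameter a runs from 0 to 1 for t <= 1/2 and b for t >= 1/2, so b = 0
    while g is shrunk and a = 1 while the resulting constant moves to q. *)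
Lemma avoiding_contractible : contractible R C.
Proof.
exists (cst q); first exact: cst_avoiding_closure.
have Cz0 g : C g -> X (g z0).
  apply: (closure_sub_preimage (@eval_continuous _ _ _ Z z0)) => // k [[_ kX] _].
  by apply: kX; exists z0.
pose a (t : R) := Num.min 1 (2 * t).
pose b (t : R) := Num.max 0 (2 * t - 1).
exists (fun y => (fun z => (1 - a y.1) *: y.2 z
  + a y.1 *: ((1 - b y.1) *: y.2 z0 + b y.1 *: q)) : maps).
split.
- apply: within_ptws_continuous => -[t g] z _.
  have t_cvg (c : R -> R) : continuous c ->
      (fun y : R * maps => c y.1) @ nbhs (t, g) --> c t.
    move=> cc; apply: (@cvg_comp _ _ _ (fun y : R * maps => y.1) c _ (nbhs t)).
      exact: cvg_fst.
    exact: cc.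
  have g_cvg z' : (fun y : R * maps => y.2 z') @ nbhs (t, g) --> g z'.
    by apply: (cvg_eval (H := snd)); exact: cvg_snd.
  have double_continuous : continuous (fun s : R => 2 * s).
    by move=> s; apply: cvgMl_tmp; exact: cvg_id.
  apply: cvg_within_filter.
  apply: (cvg_comb (a := fun y : R * maps => a y.1)
    (u := fun y : R * maps => y.2 z)) => //.
    apply: t_cvg => s; apply: (@continuous_min _ R (fun=> 1) (fun s => 2 * s)).
      exact: cvg_cst.
    exact: double_continuous.
  apply: (cvg_comb (a := fun y : R * maps => b y.1)
    (u := fun y : R * maps => y.2 z0) (v := fun=> q)) => //; last exact: cvg_cst.
  apply: t_cvg => s.
  apply: (@continuous_max _ R (fun=> 0) (fun s => 2 * s - 1)).
    exact: cvg_cst.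
  by apply: cvgB; [exact: double_continuous|exact: cvg_cst].
- move=> t g; rewrite in_itv/= => /andP[t0 t1] Cg.
  have [t12|t12] := leP t (2^-1).
    have b0 : b t = 0 by rewrite /b; apply/max_idPl; lra.
    rewrite /= b0 subr0 scale1r scale0r addr0; apply: shrink_avoiding => //.
    by rewrite /a le_min ge_min lexx ler01 mulr_ge0.
  have a1 : a t = 1 by rewrite /a; apply/min_idPl; lra.
  have -> : (fun z => (1 - a (t, g).1) *: (t, g).2 z
      + a (t, g).1 *: ((1 - b (t, g).1) *: (t, g).2 z0 + b (t, g).1 *: q))
      = cst ((1 - b t) *: g z0 + b t *: q).
    by apply/funext => z /=; rewrite a1 subrr scale0r scale1r add0r.
  apply: cst_avoiding_closure; apply: convex_comb => //; first exact: Cz0.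
  by rewrite /b le_max lexx/= ge_max ler01; lra.
- move=> g _; apply/funext => z /=.
  by rewrite /a mulr0 min_r// subr0 scale1r scale0r addr0.
- move=> g _; apply/funext => z /=.
  have -> : a 1 = 1 by rewrite /a; apply/min_idPl; lra.
  have -> : b 1 = 1 by rewrite /b max_r; lra.
  by rewrite subrr !scale0r !scale1r !add0r.
Qed.
End LowDimensional.
End Homotopies.

Theorem proposition8p5 (R : realType) (U V W : normedVectType R)
    (X : set U) (Y : set V) (Z : set W)
    (cptX : compact X) (convX : convex_set X)
    (cptY : compact Y) (convY : convex_set Y)
    (cptZ : compact Z) (convZ : convex_set Z) (Z0 : Z !=set0)
    (f : Y -> U) (homf : affine_hom Y X f) :
  (affine_dim (range f) = affine_dim X ->
   strong_deformation_retract R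
     [set (cst x : {ptws Z -> U}) | x in relboundary X] (avoiding X Z f))
  /\ (affine_dim (range f) <> affine_dim X ->
      contractible R (avoiding X Z f)).
Proof.
have [w Zw] := Z0; pose z0 : Z := SigSub (mem_set Zw).
have clX : closed X by apply: compact_closed => //; exact: norm_hausdorff.
have convI := convex_range convY homf.1.
have IX := homf.2.
rewrite /avoiding -/(hom_avoiding X (range f) Z).
(* The empty set has dimension -1, so X and the image are empty together when
   the dimensions agree, and there are no maps from Z to an empty X. *)
have [X0|X0] := pselect (X !=set0); last first.
  have XE : X = set0 by apply: contrapT => /eqP/set0P.
  have IE : range f = set0 by rewrite -subset0 -XE.
  split=> [_|]; last by rewrite IE XE.
  have DE : hom_avoiding X (range f) Z = set0.
    rewrite -subset0 => g [[_ gX] _]; apply: X0; exists (g z0); apply: gX.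
    by exists z0.
  rewrite DE closure0; split.
    by move=> g [x [Xx _] _]; case: X0; exists x.
  exists snd; split=> //.
  by rewrite setX0; exact: continuous_subspace0.
have [I0|I0] := pselect (range f !=set0); last first.
  have IE : range f = set0 by apply: contrapT => /eqP/set0P.
  have [x Xx] := X0.
  split; last first.
    move=> _; apply: (avoiding_contractible z0 cptX convX convZ Xx).
    by move=> /(_ set0); apply; split=> //; rewrite IE.
  by rewrite (affine_dim_neq0 X0) /affine_dim IE; case: asboolP.
split=> [dimE|dimN].
  have eIX := dim_eq_aff IX I0 dimE.
  rewrite -(closure_id _).1; last first.
    by apply: hom_avoiding_closed => //; rewrite eIX; exact: sub_aff.
  exact: relboundary_retract.
have /existsNP[q /not_implyP[Xq affq]] : ~ X `<=` aff (range f).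
  move=> XI; apply: dimN; apply: aff_eq_dim => //.
  apply/seteqP; split; first exact: aff_subset.
  exact: affine_subset (@aff_affine _ _ _) XI.
exact: avoiding_contractible Xq affq.
Qed.
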